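(* A finite simple graph $G$ is $(2,2)$-tight if and only if it can be obtained from $K_1$ by sequential application of moves of four types, namely the Henneberg 1 move, the Henneberg 2 move, the vertex-to-$K_4$ move and the vertex-to-$4$-cycle move.
   Context: A graph $G=(V,E)$ is $(2,k)$-sparse if every subgraph $H$ with at least one edge satisfies $|E(H)|\le 2|V(H)|-k$, and $(2,k)$-tight if it is $(2,k)$-sparse and $|E|=2|V|-k$. Moves on a simple graph $G$: Henneberg 1: add a new vertex $v$ and two edges $vv_1,vv_2$ to distinct existing vertices $v_1,v_2$. Henneberg 2: remove an edge $v_1v_2$ and add a new vertex $v$ with edges $vv_1,vv_2,vv_3$ to distinct vertices $v_1,v_2,v_3$ for some existing $v_3$. Vertex-to-$K_4$: replace a vertex $v$ by a copy of $K_4$ on four new vertices, each edge $xv$ being replaced by an edge $xw$ for some (arbitrarily chosen) vertex $w$ of the $K_4$. Vertex-to-$4$-cycle: for a vertex $v_1$ with distinct neighbours $v_2,v_3$, add a new vertex $v_0$ and edges $v_0v_2,v_0v_3$, and replace each other edge $xv_1$ ($x\ne v_2,v_3$) either by keeping it or by replacing it with $xv_0$. *)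

(* Defs.v *)
From mathcomp Require Import all_boot.
Set Implicit Arguments. Unset Strict Implicit. Unset Printing Implicit Defensive.

(* A finite simple graph: a finType T with a symmetric irreflexive e : rel T.
   Edges are the 2-element sets {x,y} with e x y. *)
Definition edges (T : finType) (e : rel T) : {set {set T}} :=
  [set [set x; y] | x in [set: T], y in [set: T] & e x y].

Definition subgraph (T : finType) (e : rel T) (X : {set T}) (F : {set {set T}}) :=
  F \subset edges e /\ (forall f, f \in F -> f \subset X).

(* (2,k)-sparse: every subgraph with at least one edge has |E(H)| <= 2|V(H)| - k
   (stated as |E(H)| + k <= 2|V(H)|, which is the same over the integers). *)
Definition sparse2 (k : nat) (T : finType) (e : rel T) :=
  forall X F, subgraph e X F -> F != set0 -> #|F| + k <= 2 * #|X|.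

Definition tight2 (k : nat) (T : finType) (e : rel T) :=
  sparse2 k e /\ #|edges e| + k = 2 * #|T|.

(* A graph is a vertex list V : seq nat (read as a set) and an adjacency
   relation A : rel nat, of which only the values on V x V matter.
   Each move specifies the new adjacency on all pairs of new vertices,
   reading the old adjacency only on old vertices. *)

Definition upair (x y a b : nat) : bool := ((x == a) && (y == b)) || ((x == b) && (y == a)).

Definition henneberg1 (V : seq nat) (A : rel nat) (V' : seq nat) (A' : rel nat) :=
  exists v v1 v2,
    [/\ v \notin V, [&& v1 \in V, v2 \in V & v1 != v2], V' = v :: V &
     forall x y, x \in V' -> y \in V' ->
       A' x y = [|| [&& x \in V, y \in V & A x y], upair x y v v1 | upair x y v v2]].

Definition henneberg2 (V : seq nat) (A : rel nat) (V' : seq nat) (A' : rel nat) :=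
  exists v v1 v2 v3,
    [/\ v \notin V, [&& v1 \in V, v2 \in V, v3 \in V, v1 != v2, v1 != v3 & v2 != v3],
        A v1 v2, V' = v :: V &
     forall x y, x \in V' -> y \in V' ->
       A' x y = [|| [&& x \in V, y \in V, A x y & ~~ upair x y v1 v2],
                    upair x y v v1, upair x y v v2 | upair x y v v3]].

(* Vertex-to-K4: replace vertex v by a K4 on four new vertices w1..w4; each
   edge x v is replaced by x (c x) where c x is an arbitrarily chosen vertex
   of the K4. *)
Definition vertex_to_K4 (V : seq nat) (A : rel nat) (V' : seq nat) (A' : rel nat) :=
  exists v w1 w2 w3 w4 (c : nat -> nat),
    let W := [:: w1; w2; w3; w4] in
    [/\ v \in V, uniq W && all (fun w => w \notin V) W,
        (forall x, x \in V -> A x v -> c x \in W),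
        V' = W ++ filter (predC1 v) V &
     forall x y, x \in V' -> y \in V' ->
       A' x y = [|| [&& x \in V, y \in V & A x y],
                    [&& x \in V, y \in W, A x v & c x == y],
                    [&& x \in W, y \in V, A y v & c y == x]
                  | [&& x \in W, y \in W & x != y]]].

(* Vertex-to-4-cycle: for a vertex v1 with distinct neighbours v2, v3, add a
   new vertex v0 with edges v0 v2, v0 v3, and each other edge x v1
   (x <> v2, v3) is either kept (b x = false) or replaced by x v0 (b x = true). *)
Definition vertex_to_4cycle (V : seq nat) (A : rel nat) (V' : seq nat) (A' : rel nat) :=
  exists v0 v1 v2 v3 (b : nat -> bool),
    [/\ v0 \notin V, [&& v1 \in V, v2 \in V & v3 \in V],
        [&& A v1 v2, A v1 v3 & v2 != v3], V' = v0 :: V &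
     forall x y, x \in V' -> y \in V' ->
       A' x y = [|| [&& x \in V, y \in V, A x y, x != v1 & y != v1],
                    [&& x == v1, y \in V, A y v1 & (y \in [:: v2; v3]) || ~~ b y],
                    [&& y == v1, x \in V, A x v1 & (x \in [:: v2; v3]) || ~~ b x],
                    [&& x == v0, y \in V & (y \in [:: v2; v3]) || A y v1 && b y]
                  | [&& y == v0, x \in V & (x \in [:: v2; v3]) || A x v1 && b x]]].

Definition move (V : seq nat) (A : rel nat) (V' : seq nat) (A' : rel nat) :=
  [\/ henneberg1 V A V' A', henneberg2 V A V' A', vertex_to_K4 V A V' A'
    | vertex_to_4cycle V A V' A'].

Inductive constructible : seq nat -> rel nat -> Prop :=
  | constr_K1 : constructible [:: 0] (fun _ _ => false)
  | constr_move V A V' A' : constructible V A -> move V A V' A' -> constructible V' A'.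

Definition iso_to (T : finType) (e : rel T) (V : seq nat) (A : rel nat) :=
  exists f : T -> nat,
    [/\ injective f, (forall x, f x \in V), (forall v, v \in V -> exists x, f x = v) &
        forall x y, e x y = A (f x) (f y)].

(* Main.v *)
(** Moves preserve tightness by counting edges in each vertex subset of the new
   graph. For the converse, a tight graph on at least two vertices has a vertex
   [v] of degree 2 or 3. Degree 2 is an inverse Henneberg 1 move. If
   [N(v) = {a, b, c}], call a pair of neighbours blocked when a tight vertex set
   avoiding [v] contains it. Tight sets that meet have a tight union, and adding
   to a tight set an outside vertex with two neighbours in it keeps it tight,
   while three neighbours are impossible. Hence if [a, b, c] are not pairwise
   adjacent, some nonadjacent pair is not blocked and an inverse Henneberg 2 move
   applies. Otherwise [{v, a, b, c}] is a K4. If every other vertex sends at most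
   one edge to it, contract it. If some [x] is adjacent to [a] and [b], merge [v]
   into [x] (delete [v], add [xc]): this inverse 4-cycle move always works, since a
   tight set containing [x] and [c] would grow to a tight set containing
   [a], or [a] and [b], and contradict the bound for [b] or [v]. *)

Require Import Defs.
From mathcomp Require Import all_boot.
From mathcomp Require Import zify.
Set Implicit Arguments. Unset Strict Implicit. Unset Printing Implicit Defensive.

(** * Edge counts *)

Section EdgeCount.
Variable I : eqType.
Implicit Types (A B : rel I) (s t V : seq I) (x y v : I).

Lemma count_sum (p : pred I) s : count p s = \sum_(x <- s) p x.
Proof. by elim: s => [|x s IH]; rewrite ?big_nil ?big_cons //= IH. Qed.

(* Each pair of positions of [s] is counted once, so this is the number of edges
   induced by [s] when [s] is duplicate-free and [A] symmetric. *)
Fixpoint nedges A s :=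
  if s is x :: s' then count (A x) s' + nedges A s' else 0.

Definition cross A s t := \sum_(x <- s) count (A x) t.

Lemma nedges_cat A s t : nedges A (s ++ t) = nedges A s + nedges A t + cross A s t.
Proof.
elim: s => [|x s IH] /=; first by rewrite /cross big_nil addn0.
by rewrite count_cat IH /cross big_cons; lia.
Qed.

Lemma handshake A s : {in s &, symmetric A} -> {in s, irreflexive A} ->
  \sum_(x <- s) count (A x) s = 2 * nedges A s.
Proof.
elim: s => [|v s IH] symA irrA; first by rewrite big_nil.
rewrite big_cons /= irrA ?mem_head // add0n big_split /= IH; first last.
- by move=> x xs; apply: irrA; rewrite in_cons xs orbT.
- by move=> x y xs ys; apply: symA; rewrite in_cons ?xs ?ys orbT.
have -> : \sum_(x <- s) A x v = count (A v) s.
  rewrite count_sum; apply: eq_big_seq => x xs.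
  by rewrite symA ?mem_head ?in_cons ?xs ?orbT.
by lia.
Qed.

(** The recursion depends on the order of the list, but by [handshake] twice its value is a degree
    sum, which does not. *)
Lemma nedges_perm A s t : {in s &, symmetric A} -> {in s, irreflexive A} ->
  perm_eq s t -> nedges A s = nedges A t.
Proof.
move=> symA irrA st; have /handshake hs := symA; have:= hs irrA.
have mem_st := perm_mem st.
rewrite (perm_big _ st) /=.
under eq_bigr => x _ do rewrite (permP st).
rewrite handshake; first by lia.
- by move=> x y; rewrite -!mem_st; apply: symA.
- by move=> x; rewrite -mem_st; apply: irrA.
Qed.

Lemma leq_nedges A B s : {in s &, forall x y, A x y -> B x y} ->
  nedges A s <= nedges B s.
Proof.
elim: s => [|v s IH] //= AB; apply: leq_add.
  rewrite !count_sum big_seq [leqRHS]big_seq.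
  apply: leq_sum => x xs; have := AB v x; rewrite mem_head in_cons xs orbT.
  by case: (A v x); case: (B v x) => // /(_ isT isT isT).
by apply: IH => x y xs ys; apply: AB; rewrite in_cons ?xs ?ys orbT.
Qed.

Lemma eq_in_nedges A B s : {in s &, A =2 B} -> nedges A s = nedges B s.
Proof.
by move=> AB; apply/eqP; rewrite eqn_leq !leq_nedges // => x y xs ys; rewrite AB.
Qed.

Lemma count_or2 s a b : uniq s -> a != b ->
  count (fun y => (y == a) || (y == b)) s = (a \in s) + (b \in s).
Proof.
move=> us ab; rewrite -!(count_uniq_mem _ us) !count_sum -big_split.
apply: eq_bigr => y _ /=; case: eqP => [->|] //=; first by rewrite (negPf ab).
Qed.

(** Serves in both directions: [B] is the old graph in the Henneberg 2 move and the reduced graph in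
    its inverse. *)
Lemma nedges_add_edge A B s a b : uniq s -> a != b -> ~~ A a b -> ~~ A b a ->
  {in s &, forall x y, B x y = A x y || ((x == a) && (y == b) || (x == b) && (y == a))} ->
  nedges B s = nedges A s + (a \in s) && (b \in s).
Proof.
move=> + ab Aab Aba; elim: s => [|v s IH] //= /andP[vs us] BA.
have {}IH : nedges B s = nedges A s + (a \in s) && (b \in s).
  by apply: IH => // x y xs ys; apply: BA; rewrite in_cons ?xs ?ys orbT.
(* The row of [v] gains [b] if [v] is [a], and gains [a] if [v] is [b]. *)
have -> : count (B v) s = count (A v) s + ((v == a) * (b \in s) + (v == b) * (a \in s)).
  rewrite -!(count_uniq_mem _ us) !count_sum !big_distrr -!big_split /=.
  apply: eq_big_seq => y ys; rewrite BA ?mem_head ?in_cons ?ys ?orbT //.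
  case: (eqVneq v a) => [->|va] /=.
    by rewrite (negPf ab); case: (eqVneq y b) => [->|_]; rewrite ?(negPf Aab);
      case: (A a y); case: (y == a).
  case: (eqVneq v b) => [->|vb] /=.
    by case: (eqVneq y a) => [->|_]; rewrite ?(negPf Aba); case: (A b y); case: (y == b).
  by case: (A v y); case: (y == a); case: (y == b).
rewrite IH !in_cons (eq_sym a v) (eq_sym b v).
case: (eqVneq v a) vs => [->|_] /= vs.
  by rewrite (negPf vs) (negPf ab) /=; lia.
by case: (eqVneq v b) vs => [->|_] /= vs; rewrite ?(negPf vs) /=; lia.
Qed.

(* Induced subgraphs suffice: they maximise the edge count on a given vertex set. *)
Definition sparse V A :=
  forall s, uniq s -> {subset s <= V} -> s != [::] -> nedges A s + 2 <= 2 * size s.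

(** Symmetry and irreflexivity are asked on [V] only, because a move prescribes the new adjacency on
    the new vertices and nowhere else. *)
Definition tight V A :=
  [/\ uniq V, {in V &, symmetric A}, {in V, irreflexive A}, sparse V A &
      nedges A V + 2 = 2 * size V].

(** A set through [v] is [v] added to some [s], and the two units that [v] adds to [2 * size] cancel
    the [+ 2] of the bound. If [s] is empty the set is a single vertex, where the bound is
    immediate. *)
Lemma tight_cons v V A : uniq (v :: V) ->
  {in v :: V &, symmetric A} -> {in v :: V, irreflexive A} ->
  sparse V A ->
  (forall s, uniq s -> {subset s <= V} -> s != [::] ->
     nedges A s + count (A v) s <= 2 * size s) ->
  nedges A V + count (A v) V = 2 * size V ->
  tight (v :: V) A.
Proof.
move=> uV symA irrA spV spv eqV; split=> //=; last by lia.
move=> s us sV s0; case: (boolP (v \in s)) => vs; last first.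
  apply: spV => // x xs; have := sV x xs; rewrite in_cons.
  by case: eqP xs vs => // -> ->.
have ps := perm_to_rem vs.
rewrite (perm_size ps) (nedges_perm _ _ ps); first last.
- by move=> x /sV; apply: irrA.
- by move=> x y /sV xV /sV yV; apply: symA.
move: (us); rewrite (perm_uniq ps) /= => /andP[vr ur].
have rV : {subset rem v s <= V}.
  move=> x xr; have := sV x (mem_rem xr); rewrite in_cons.
  by case: eqP xr vr => // -> ->.
case: (eqVneq (rem v s) [::]) => [->|r0] //=.
by have := spv _ ur rV r0; lia.
Qed.

Lemma tight_perm V V' A : perm_eq V V' -> tight V A -> tight V' A.
Proof.
move=> pV [uV symA irrA spV eqV]; have mV := perm_mem pV; split.
- by rewrite -(perm_uniq pV).
- by move=> x y; rewrite -!mV; apply: symA.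
- by move=> x; rewrite -mV; apply: irrA.
- by move=> s us sV; apply: spV => // x /sV; rewrite mV.
- by rewrite -(perm_size pV) -(nedges_perm _ _ pV).
Qed.

End EdgeCount.

Lemma nedges_map (I J : eqType) (f : I -> J) A s :
  nedges A (map f s) = nedges (fun x y => A (f x) (f y)) s.
Proof. by elim: s => //= x s ->; rewrite count_map. Qed.

(** * The moves preserve tightness *)

Ltac mem_lia := simpl; repeat match goal with |- context [?x \in ?s] => case: (x \in s) end; simpl; clear; lia.

Lemma mem_neq (I : eqType) (V : seq I) x y : x \in V -> y \notin V -> (x == y) = false.
Proof. by move=> xV; apply: contraNF => /eqP <-. Qed.

Lemma leq_in_sum (I : eqType) (s : seq I) (F G : I -> nat) :
  {in s, forall x, F x <= G x} -> \sum_(x <- s) F x <= \sum_(x <- s) G x.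
Proof. by move=> FG; rewrite big_seq [leqRHS]big_seq; apply: leq_sum. Qed.

Lemma upairC x y a b : upair x y a b = upair y x a b.
Proof. by rewrite /upair orbC ![(x == _) && _]andbC. Qed.

(** The new vertex sends at most two edges to an old set, which the slack of 2 in the bound for that
    set absorbs. *)
Lemma henneberg1_tight V A V' A' : tight V A -> henneberg1 V A V' A' -> tight V' A'.
Proof.
move=> [uV symA irrA spV eqV] [v [v1 [v2 [vV /and3P[v1V v2V v12] -> E]]]].
have AV : {in V &, A' =2 A}.
  move=> x y xV yV; rewrite E ?in_cons ?xV ?yV ?orbT //.
  by rewrite /upair !(mem_neq _ vV) //= !andbF !orbF.
have Av : {in V, forall y, A' v y = (y == v1) || (y == v2)}.
  move=> y yV; rewrite E ?in_cons ?eqxx ?yV ?orbT // (negPf vV) /=.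
  by rewrite /upair eqxx !(mem_neq _ vV) //= !andbF !orbF.
apply: tight_cons => /=; first by rewrite vV.
- move=> x y xV yV; rewrite !E // ![upair x y _ _]upairC.
  by case xV': (x \in V); case yV': (y \in V) => //=; rewrite symA.
- move=> x xV; rewrite E //.
  case xV': (x \in V); rewrite /= ?(irrA x) //= /upair.
    by rewrite !(mem_neq _ vV) //= !andbF.
  by rewrite ![x == v1]eq_sym ![x == v2]eq_sym !(mem_neq _ (negbT xV')) // !andbF.
- move=> s us sV s0; rewrite (eq_in_nedges (B := A)) ?spV //.
  by move=> x y /sV xV /sV yV; apply: AV.
- move=> s us sV s0; rewrite (eq_in_nedges (B := A)); last first.
    by move=> x y /sV xV /sV yV; apply: AV.
  rewrite (eq_in_count (a2 := fun y => (y == v1) || (y == v2))); last by move=> y /sV; apply: Av.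
  by rewrite count_or2 //; have := spV _ us sV s0; mem_lia.
by move: eqV; rewrite (eq_in_nedges AV) (eq_in_count Av) count_or2 // v1V v2V; mem_lia.
Qed.

Lemma count_or3 (I : eqType) (s : seq I) a b c : uniq s -> a != b -> a != c -> b != c ->
  count (fun y => [|| y == a, y == b | y == c]) s = (a \in s) + (b \in s) + (c \in s).
Proof.
move=> us ab ac bc; rewrite -!(count_uniq_mem _ us) !count_sum -!big_split /=.
apply: eq_bigr => y _; case: (eqVneq y a) => [->|_] /=; first by rewrite (negPf ab) (negPf ac).
by case: (eqVneq y b) => [->|_] //=; rewrite (negPf bc).
Qed.

(** The new vertex sends three edges to a set only if the set contains [v1], [v2] and [v3]; the
    deleted edge between [v1] and [v2] then compensates for the third one. *)
Lemma henneberg2_tight V A V' A' : tight V A -> henneberg2 V A V' A' -> tight V' A'.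
Proof.
move=> [uV symA irrA spV eqV] [v [v1 [v2 [v3 [vV]]]]].
move=> /and4P[v1V v2V v3V /and3P[v12 v13 v23]] A12 -> E.
have AV : {in V &, forall x y, A' x y = A x y && ~~ upair x y v1 v2}.
  move=> x y xV yV; rewrite E ?in_cons ?xV ?yV ?orbT //=.
  by rewrite /upair !(mem_neq _ vV) //= !andbF !orbF.
have AV' : {in V &, forall x y, A x y = A' x y || upair x y v1 v2}.
  move=> x y xV yV; rewrite AV //; case u12: (upair x y v1 v2); last by rewrite andbT orbF.
  by move: u12 => /orP[] /andP[/eqP-> /eqP->]; rewrite ?orbT // symA // A12.
have nedgesE s : uniq s -> {subset s <= V} ->
    nedges A s = nedges A' s + (v1 \in s) && (v2 \in s).
  move=> us sV; apply: nedges_add_edge => //; first by rewrite AV // /upair !eqxx andbF.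
    by rewrite AV // /upair !eqxx orbT andbF.
  by move=> x y /sV xV /sV yV; apply: AV'.
have Av : {in V, forall y, A' v y = [|| y == v1, y == v2 | y == v3]}.
  move=> y yV; rewrite E ?in_cons ?eqxx ?yV ?orbT // (negPf vV) /=.
  by rewrite /upair eqxx !(mem_neq _ vV) //= !andbF !orbF.
apply: tight_cons => /=; first by rewrite vV.
- move=> x y xV yV; rewrite !E // ![upair x y _ _]upairC.
  by case xV': (x \in V); case yV': (y \in V) => //=; rewrite symA.
- move=> x xV; rewrite E //.
  case xV': (x \in V); rewrite /= ?(irrA x) //= /upair.
    by rewrite !(mem_neq _ vV) //= !andbF.
  by rewrite ![x == v1]eq_sym ![x == v2]eq_sym ![x == v3]eq_sym
    !(mem_neq _ (negbT xV')) // !andbF.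
- by move=> s us sV s0; have := spV s us sV s0; rewrite nedgesE //; mem_lia.
- move=> s us sV s0; have := spV s us sV s0; rewrite nedgesE //.
  rewrite (eq_in_count (a2 := fun y => [|| y == v1, y == v2 | y == v3])); last by move=> y /sV; apply: Av.
  by rewrite count_or3 //; mem_lia.
move: eqV; rewrite nedgesE // (eq_in_count Av) count_or3 // v1V v2V v3V; mem_lia.
Qed.

(** Sets through [v0] are compared with old sets through [v1]. If [v1] is also present, identifying
    the two vertices loses at most the two doubled edges to [v2] and [v3]. *)
Lemma vertex_to_4cycle_tight V A V' A' :
  tight V A -> vertex_to_4cycle V A V' A' -> tight V' A'.
Proof.
move=> [uV symA irrA spV eqV] [v0 [v1 [v2 [v3 [b [v0V]]]]]].
move=> /and3P[v1V v2V v3V] /and3P[A12 A13 v23] -> E.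
have v01 : v0 != v1 by apply: contraNneq v0V => ->.
have v12 : v1 != v2 by apply: contraTneq A12 => <-; rewrite irrA.
have v13 : v1 != v3 by apply: contraTneq A13 => <-; rewrite irrA.
have AV : {in V &, forall x y, x != v1 -> y != v1 -> A' x y = A x y}.
  move=> x y xV yV xv yv; rewrite E ?in_cons ?xV ?yV ?orbT //=.
  by rewrite xv yv (negPf xv) (negPf yv) !(mem_neq _ v0V) //= !andbT !orbF.
have A1 : {in V, forall y, y != v1 -> A' v1 y = A y v1 && (y \in [:: v2; v3]) || (A y v1 && ~~ b y)}.
  move=> y yV yv; rewrite E ?in_cons ?v1V ?yV ?orbT // !eqxx /= !(mem_neq _ v0V) //.
  by rewrite (negPf yv) /= !andbF !orbF -andb_orr.
have A0 : {in V, forall y, A' v0 y = (y \in [:: v2; v3]) || A y v1 && b y}.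
  move=> y yV; rewrite E ?in_cons ?eqxx ?yV ?orbT //= (negPf v0V) (negPf v01) /=.
  by rewrite !(mem_neq _ v0V) //= !andbF !orbF.
have A123 y : y \in [:: v2; v3] -> A y v1.
  by rewrite !inE => /orP[] /eqP ->; rewrite symA.
have A01 : A' v0 v1 = false.
  by rewrite A0 // !inE (negPf v12) (negPf v13) irrA.
have leAA : {in V &, forall x y, A' x y -> A x y}.
  move=> x y xV yV; case: (eqVneq x v1) => [->|xv]; last first.
    case: (eqVneq y v1) => [->|yv]; last by rewrite AV.
    rewrite E ?in_cons ?xV ?v1V ?orbT // !eqxx (negPf xv) !(mem_neq _ v0V) //= !andbF !orbF.
    by move=> /andP[].
  case: (eqVneq y v1) => [->|yv].
    by rewrite E ?in_cons ?v1V ?orbT // !eqxx !(mem_neq _ v0V) //= !irrA //= !andbF.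
  by rewrite A1 // symA // => /orP[] /andP[].
(* Each old edge at [v1] ends up at exactly one of [v1] and [v0], except that those to [v2] and [v3]
   appear at both. *)
have split1 t : uniq t -> {subset t <= V} -> v1 \notin t ->
    count (A' v1) t + count (A' v0) t = count (A v1) t + (v2 \in t) + (v3 \in t).
  move=> ut tV v1t; rewrite -!(count_uniq_mem _ ut) !count_sum -!big_split /=.
  apply: eq_big_seq => y yt; have yV := tV y yt.
  have yv : y != v1 by apply: contraNneq v1t => <-.
  rewrite A1 // A0 // [A v1 y]symA //; move: (A123 y); rewrite !inE.
  case: (eqVneq y v2) => [->|_] /=; first by rewrite (negPf v23) => ->.
  case: (eqVneq y v3) => [_|_] /=; first by move=> ->.
  by case: (A y v1); case: (b y).
have perm1 B s : {in V &, symmetric B} -> {in V, irreflexive B} -> {subset s <= V} -> v1 \in s ->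
    nedges B s = count (B v1) (rem v1 s) + nedges B (rem v1 s).
  move=> sB iB sV v1s; rewrite (nedges_perm _ _ (perm_to_rem v1s)) //.
    by move=> x y /sV xV /sV; apply: sB.
  by move=> x /sV; apply: iB.
have symA' : {in v0 :: V &, symmetric A'}.
  move=> x y xV yV; rewrite !E //.
  have -> : [&& x \in V, y \in V, A x y, x != v1 & y != v1] =
            [&& y \in V, x \in V, A y x, y != v1 & x != v1].
    case xV': (x \in V); case yV': (y \in V) => //=.
    by rewrite symA // [(x != v1) && _]andbC.
  by congr (_ || _); rewrite orbCA; congr (_ || (_ || _)); apply: orbC.
have irrA' : {in v0 :: V, irreflexive A'}.
  move=> x; rewrite in_cons => /orP[/eqP ->|xV].
    by rewrite E ?mem_head // (negPf v0V) (negPf v01) /= !andbF.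
  by apply/negP => /(leAA _ _ xV xV); rewrite irrA.
have symV : {in V &, symmetric A'} by move=> x y xV yV; apply: symA'; rewrite in_cons ?xV ?yV orbT.
have irrV : {in V, irreflexive A'} by move=> x xV; apply: irrA'; rewrite in_cons ?xV orbT.
have AV1 t : {subset t <= V} -> v1 \notin t -> nedges A' t = nedges A t.
  move=> tV v1t; apply: eq_in_nedges => x y xt yt.
  by apply: AV; rewrite ?tV //; apply: contraNneq v1t => <-.
have mono s : {subset s <= V} -> nedges A' s <= nedges A s.
  by move=> sV; apply: leq_nedges => x y /sV xV /sV; apply: leAA.
have full s : uniq s -> {subset s <= V} -> v1 \in s ->
    nedges A' s + count (A' v0) s = nedges A s + (v2 \in s) + (v3 \in s).
  move=> us sV v1s; have ps := perm_to_rem v1s.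
  have rV : {subset rem v1 s <= V} by move=> x /mem_rem/sV.
  move: (us); rewrite (perm_uniq ps) /= => /andP[v1r ur].
  rewrite (perm1 A') // (perm1 A) // (permP ps) /= A01 AV1 //.
  have := split1 _ ur rV v1r; rewrite !(perm_mem ps) !in_cons.
  by rewrite [v2 == _]eq_sym [v3 == _]eq_sym (negPf v12) (negPf v13); mem_lia.
apply: tight_cons => //=; first by rewrite v0V.
- by move=> s us sV s0; apply: leq_trans (spV s us sV s0); rewrite leq_add2r mono.
- move=> s us sV s0; case: (boolP (v1 \in s)) => v1s.
    by rewrite full //; have := spV s us sV s0; mem_lia.
  (* Without [v1], the neighbours of [v0] in [s] are among the old neighbours of [v1], so the old
     bound for [v1 :: s] suffices. *)
  have : nedges A (v1 :: s) + 2 <= 2 * size (v1 :: s).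
    by apply: spV => //=; [rewrite v1s | move=> x; rewrite in_cons => /orP[/eqP->|/sV]].
  have : count (A' v0) s <= count (A v1) s.
    rewrite !count_sum; apply: leq_in_sum => y ys; have yV := sV y ys.
    rewrite A0 // [A v1 y]symA //; case yv: (y \in _) => /=; first by rewrite A123.
    by case: (A y v1) (b y) => [] [].
  by rewrite AV1 //; mem_lia.
by move: eqV; rewrite full // v2V v3V; mem_lia.
Qed.

Lemma nedges_clique (I : eqType) (A : rel I) s : 2 * nedges A s <= size s * (size s).-1.
Proof.
elim: s => [|x s IH] //=; have := count_size (A x) s.
by case: (size s) IH => [|n] /=; nia.
Qed.

Lemma nedges_complete (I : eqType) (A : rel I) s : uniq s ->
  {in s &, forall x y, A x y = (x != y)} -> 2 * nedges A s = size s * (size s).-1.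
Proof.
elim: s => [|x s IH] //= /andP[xs us] As.
have -> : count (A x) s = size s.
  apply/eqP; rewrite -all_count; apply/allP => y ys.
  by rewrite As ?mem_head ?in_cons ?ys ?orbT //; apply: contraNneq xs => ->.
have := IH us _; rewrite mulnDr => ->; first by case: (size s) => [|n] /=; nia.
by move=> y z ys zs; apply: As; rewrite in_cons ?ys ?zs orbT.
Qed.

(** A set splits into old vertices [s2] and vertices [s1] of the K4. If [s1] is nonempty, shrinking
    it to the single vertex [v] gives an old set whose bound is known. *)
Lemma vertex_to_K4_tight V A V' A' : tight V A -> vertex_to_K4 V A V' A' -> tight V' A'.
Proof.
move=> [uV symA irrA spV eqV] [v [w1 [w2 [w3 [w4 [c]]]]]].
have sW : size [:: w1; w2; w3; w4] = 4 by [].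
move: [:: w1; w2; w3; w4] sW => W sW [vV /andP[uW /allP WV] cW -> E].
pose U := filter (predC1 v) V; rewrite -/U in E *.
have UV : {subset U <= V} by move=> x; rewrite mem_filter => /andP[].
have vU : v \notin U by rewrite mem_filter /= eqxx.
have uU : uniq U by apply: filter_uniq.
have pV : perm_eq V (v :: U).
  by rewrite /U -rem_filter //; apply: perm_to_rem.
have WU x : x \in U -> (x \in W) = false.
  by move=> /UV xV; apply: contraTF xV => /WV.
have memV' x : (x \in W ++ U) = (x \in W) || (x \in U) by rewrite mem_cat.
have AU : {in U &, A' =2 A}.
  move=> x y xU yU; rewrite E ?memV' ?xU ?yU ?orbT //.
  by rewrite (UV x) // (UV y) // (WU x) // (WU y) //= orbF.
have AW : {in W &, forall x y, A' x y = (x != y)}.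
  move=> x y xW yW; rewrite E ?memV' ?xW ?yW //.
  by rewrite (negPf (WV x xW)) (negPf (WV y yW)).
have AUW : {in U & W, forall x y, A' x y = A x v && (c x == y)}.
  move=> x y xU yW; rewrite E ?memV' ?xU ?yW ?orbT //.
  by rewrite (UV x) // (WU x) // (negPf (WV y yW)) /= !orbF.
have symA' : {in W ++ U &, symmetric A'}.
  move=> x y xV yV; rewrite !E //.
  have -> : [&& x \in V, y \in V & A x y] = [&& y \in V, x \in V & A y x].
    by case xV': (x \in V); case yV': (y \in V) => //=; apply: symA.
  congr (_ || _); rewrite orbCA; congr (_ || _); first by rewrite andbCA.
  by congr (_ || _); [rewrite andbCA | rewrite andbCA eq_sym].
have irrA' : {in W ++ U, irreflexive A'}.
  move=> x; rewrite memV' => /orP[xW|xU]; first by rewrite AW // eqxx.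
  by rewrite AU // irrA ?UV.
have nedges_split s1 s2 : {subset s1 <= W} -> {subset s2 <= U} ->
    nedges A' (s2 ++ s1) = nedges A s2 + nedges A' s1 + cross A' s2 s1.
  move=> s1W s2U; rewrite nedges_cat; congr (_ + _ + _).
  by apply: eq_in_nedges => x y /s2U xU /s2U; apply: AU.
have crossE s1 s2 : uniq s1 -> {subset s1 <= W} -> {subset s2 <= U} ->
    cross A' s2 s1 = \sum_(x <- s2) A x v && (c x \in s1).
  move=> us1 s1W s2U; apply: eq_big_seq => x /s2U xU.
  rewrite (eq_in_count (a2 := fun y => A x v && (c x == y))); last first.
    by move=> y /s1W; apply: AUW.
  case: (A x v) => /=; last by rewrite count_pred0.
  by rewrite -(count_uniq_mem _ us1); apply: eq_count => y /=; rewrite eq_sym.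
have uV' : uniq (W ++ U).
  rewrite cat_uniq uW uU andbT; apply/hasPn => x /=.
  by move=> xU; rewrite WU.
have Avcount s : {subset s <= U} -> count (A v) s = \sum_(x <- s) A x v.
  by move=> sU; rewrite count_sum; apply: eq_big_seq => x /sU/UV xV; rewrite symA.
split=> //.
- move=> s us sV s0; pose p := fun x => x \in U.
  have ps : perm_eq s (filter p s ++ filter (predC p) s) by rewrite perm_sym perm_filterC.
  have s2U : {subset filter p s <= U} by move=> x; rewrite mem_filter => /andP[].
  have s1W : {subset filter (predC p) s <= W}.
    move=> x; rewrite mem_filter => /andP[/= xU /sV].
    by rewrite memV' [x \in U](negPf xU) orbF.
  rewrite (perm_size ps) (nedges_perm _ _ ps); first last.
  - by move=> x /sV; apply: irrA'.
  - by move=> x y /sV xV /sV; apply: symA'.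
  have us1 : uniq (filter (predC p) s) by apply: filter_uniq.
  have us2 : uniq (filter p s) by apply: filter_uniq.
  rewrite nedges_split // crossE // size_cat.
  move: (filter p s) (filter (predC p) s) us1 us2 s1W s2U ps => s2 s1 us1 us2 s1W s2U ps.
  case: (eqVneq s1 [::]) => [s10|s10].
    rewrite s10 /= big1; last by move=> x _; rewrite in_nil andbF.
    rewrite !addn0; apply: spV => //; first by move=> x /s2U/UV.
    by apply: contra_neq s0 => s20; move: ps; rewrite s10 s20 => /perm_size/size0nil.
  have : nedges A (v :: s2) + 2 <= 2 * size (v :: s2).
    apply: spV => //=; first by rewrite us2 andbT; apply: contra vU => /s2U.
    by move=> x; rewrite in_cons => /orP[/eqP->//|/s2U/UV].
  have : \sum_(x <- s2) A x v && (c x \in s1) <= \sum_(x <- s2) A x v.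
    by apply: leq_sum => x _; case: (A x v); case: (c x \in s1).
  have := nedges_clique A' s1.
  (* With [k = size s1], the [k - 1] extra vertices allow [2(k - 1)] extra edges, and
     [k(k - 1)/2 <= 2(k - 1)] holds exactly because [1 <= k <= 4]; equality at [k = 4] gives the
     total count below. *)
  have : 0 < size s1 <= 4 by rewrite -sW uniq_leq_size // andbT; case: (s1) s10.
  rewrite /= Avcount //.
  by case: (size s1) => [|[|[|[|[]]]]] //= _; mem_lia.
have pWU : perm_eq (W ++ U) (U ++ W) by rewrite perm_catC.
rewrite (nedges_perm symA' irrA' pWU) nedges_split // crossE //.
have := nedges_complete uW AW; rewrite sW size_cat sW.
have := nedges_perm symA irrA pV; have := perm_size pV; rewrite /= Avcount //.
have -> : \sum_(x <- U) A x v && (c x \in W) = \sum_(x <- U) A x v.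
  apply: eq_big_seq => x /UV xV; case Axv: (A x v) => //=.
  by rewrite cW.
by move: eqV; mem_lia.
Qed.

Lemma constructible_tight V A : constructible V A -> tight V A.
Proof.
elim=> [|{}V {}A V' A' _ tV].
  split=> //= s us s0 sn; move: (uniq_leq_size us s0).
  by case: s {us s0} sn => [|x []].
case; [exact: henneberg1_tight | exact: henneberg2_tight
      | exact: vertex_to_K4_tight | exact: vertex_to_4cycle_tight].
Qed.

(** * Realizing the moves with fresh names *)

Section Realization.
Variable I : eqType.
Implicit Types (A B : rel I) (V R K : seq I) (x y v a b c : I).
Implicit Types (N : seq nat) (M : rel nat) (f : I -> nat).

(** [f] names the vertices by numbers. Only its values on [V] are constrained, so it may be
    redefined on a new vertex. *)
Definition realized V A N M (f : I -> nat) :=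
  [/\ constructible N M, {in V &, injective f}, N =i map f V &
      {in V &, forall x y, A x y = M (f x) (f y)}].

Definition realizable V A := exists N M f, realized V A N M f.

Lemma realizable_perm V V' A : V =i V' -> realizable V A -> realizable V' A.
Proof.
move=> VV' [N [M [f [cN injf mV AA]]]]; exists N, M, f; split=> //.
- by move=> x y; rewrite -!VV'; apply: injf.
- by move=> n; rewrite mV; apply/mapP/mapP => -[x xV ->]; exists x; rewrite // ?VV' // -VV'.
- by move=> x y; rewrite -!VV'; apply: AA.
Qed.

(** All numbers from [z] on are fresh, because the vertex-to-K4 move takes four new names at
    once. *)
Lemma exists_fresh (N : seq nat) : exists z, forall n, z <= n -> n \notin N.
Proof.
exists (sumn N).+1 => n; apply: contraL => nV; rewrite -leqNgt.
elim: N nV => //= m N IH; rewrite in_cons => /orP[/eqP->|/IH]; first exact: leq_addr.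
by move/leq_trans; apply; apply: leq_addl.
Qed.

Lemma realizable1 A v : irreflexive A -> realizable [:: v] A.
Proof.
move=> irrA; exists [:: 0], (fun _ _ => false), (fun=> 0); split=> //.
- exact: constr_K1.
- by move=> x y; rewrite !inE => /eqP-> /eqP->.
by move=> x y; rewrite !inE => /eqP-> /eqP->.
Qed.

Lemma realized_mem V A N M f x : realized V A N M f -> x \in V -> f x \in N.
Proof. by move=> [_ _ mV _] xV; rewrite mV map_f. Qed.

Lemma realized_eq V A N M f x y : realized V A N M f -> x \in V -> y \in V ->
  (f x == f y) = (x == y).
Proof. by move=> [_ injf _ _] xV yV; apply: (inj_in_eq injf). Qed.

(** The common frame of the three moves that add one vertex: [v] receives the fresh name [z], and
    what remains is to compare adjacencies. *)
Lemma realizable_extend V B A v N M f z M' :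
  symmetric A -> irreflexive A -> v \notin V -> realized V B N M f -> z \notin N ->
  constructible (z :: N) M' ->
  {in V &, forall x y, A x y = M' (f x) (f y)} ->
  {in V, forall y, A v y = M' z (f y)} ->
  {in V, forall y, A v y = M' (f y) z} ->
  M' z z = false -> realizable (v :: V) A.
Proof.
move=> symA irrA vV rN zN cA' AV Avl Avr Azz; have [_ injf mV _] := rN.
pose g x := if x == v then z else f x.
have gv : g v = z by rewrite /g eqxx.
have gV x : x \in V -> g x = f x by rewrite /g; case: eqP => // -> xV; rewrite xV in vV.
have fz x : x \in V -> (f x == z) = false by move=> xV; apply: mem_neq (realized_mem rN xV) zN.
exists (z :: N), M', g; split=> //.
- move=> x y; rewrite !in_cons => /orP[/eqP->|xV] /orP[/eqP->|yV] //.
  + by rewrite gv gV // => /eqP; rewrite eq_sym fz.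
  + by rewrite gv gV // => /eqP; rewrite fz.
  + by rewrite !gV //; apply: injf.
- move=> n; rewrite /= !in_cons gv mV; congr (_ || _).
  by congr (n \in _); apply/esym/eq_in_map => x; apply: gV.
move=> x y; rewrite !in_cons => /orP[/eqP->|xV] /orP[/eqP->|yV].
- by rewrite gv irrA Azz.
- by rewrite gv gV // Avl.
- by rewrite gv gV // symA Avr.
- by rewrite !gV // AV.
Qed.

Lemma realizable_henneberg1 V A v a b :
  symmetric A -> irreflexive A -> realizable V A -> v \notin V ->
  a \in V -> b \in V -> a != b ->
  {in V, forall y, A v y = (y == a) || (y == b)} -> realizable (v :: V) A.
Proof.
move=> symA irrA [N [M [f rN]]] vV aV bV ab Av; have [cN _ _ AA] := rN.
have [z zN] := exists_fresh N; have {}zN := zN _ (leqnn z).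
have fV := realized_mem rN; have feq := realized_eq rN.
have fz x : x \in V -> (f x == z) = false by move=> xV; apply: mem_neq (fV _ xV) zN.
pose M' p q := [|| [&& p \in N, q \in N & M p q], upair p q z (f a) | upair p q z (f b)].
apply: (@realizable_extend _ A A v N M f z M') => //.
- apply: constr_move cN _; apply: Or41; exists z, (f a), (f b).
  by split=> //; rewrite !fV // feq.
- by move=> x y xV yV; rewrite /M' /upair !fV // !fz //= !andbF !orbF AA.
- by move=> y yV; rewrite /M' /upair (negPf zN) eqxx !fz // !feq // !andbF !orbF Av.
- by move=> y yV; rewrite /M' /upair (negPf zN) eqxx !fz // !feq // !andbF !andbT Av.
by rewrite /M' /upair (negPf zN) ![z == f _]eq_sym !fz // !andbF.
Qed.

Lemma realizable_henneberg2 V A B v a b c :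
  symmetric A -> irreflexive A -> realizable V B -> v \notin V ->
  [&& a \in V, b \in V, c \in V, a != b, a != c & b != c] -> ~~ A a b ->
  {in V &, forall x y, B x y = A x y || ((x == a) && (y == b) || (x == b) && (y == a))} ->
  {in V, forall y, A v y = [|| y == a, y == b | y == c]} -> realizable (v :: V) A.
Proof.
move=> symA irrA [N [M [f rN]]] vV abc Aab BA Av; have [cN _ _ AA] := rN.
have /and4P[aV bV cV' /and3P[ab ac bc]] := abc.
have [z zN] := exists_fresh N; have {}zN := zN _ (leqnn z).
have fV := realized_mem rN; have feq := realized_eq rN.
have fz x : x \in V -> (f x == z) = false by move=> xV; apply: mem_neq (fV _ xV) zN.
pose M' p q := [|| [&& p \in N, q \in N, M p q & ~~ upair p q (f a) (f b)],
  upair p q z (f a), upair p q z (f b) | upair p q z (f c)].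
apply: (@realizable_extend _ B A v N M f z M') => //.
- apply: constr_move cN _; apply: Or42; exists z, (f a), (f b), (f c).
  split=> //; first by rewrite !fV // !feq // ab ac bc.
  by rewrite -AA // BA // !eqxx orbT.
- move=> x y xV yV; rewrite /M' /upair !fV // !fz //= !andbF !orbF -AA // BA // !feq //.
  have := symA x y; case: (eqVneq x a) => [->|_] /=.
    by rewrite (negPf ab) /=; case: (eqVneq y b) => [->|_] //=; rewrite ?(negPf Aab) // !orbF andbT.
  case: (eqVneq x b) => [->|_] /=; last by rewrite orbF andbT.
  by case: (eqVneq y a) => [->|_] /= AA'; rewrite ?orbF ?andbT ?AA' ?(negPf Aab).
- by move=> y yV; rewrite /M' /upair (negPf zN) eqxx !fz // !feq // !andbF !orbF Av.
- by move=> y yV; rewrite /M' /upair (negPf zN) eqxx !fz // !feq // !andbF !andbT Av.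
by rewrite /M' /upair (negPf zN) ![z == f _]eq_sym !fz // !andbF.
Qed.

(** The move splits [x]: the edge from [x] to [c] in [B] is handed over to [v], while [a] and [b]
    become common neighbours of [x] and [v]. *)
Lemma realizable_4cycle V A B v x a b c :
  symmetric A -> irreflexive A -> realizable V B -> v \notin V ->
  [&& x \in V, a \in V, b \in V & c \in V] -> [&& a != b, x != c & A x a && A x b] ->
  ~~ A x c ->
  {in V &, forall y w, B y w = A y w || ((y == x) && (w == c) || (y == c) && (w == x))} ->
  {in V, forall y, A v y = [|| y == a, y == b | y == c]} -> realizable (v :: V) A.
Proof.
move=> symA irrA [N [M [f rN]]] vV /and4P[xV aV bV cV'] /and3P[ab xc /andP[Axa Axb]] Axc BA Av.
have [cN _ _ AA] := rN.
have [z zN] := exists_fresh N; have {}zN := zN _ (leqnn z).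
have fV := realized_mem rN; have feq := realized_eq rN.
have fz y : y \in V -> (f y == z) = false by move=> yV; apply: mem_neq (fV _ yV) zN.
have zf y : y \in V -> (z == f y) = false by rewrite eq_sym; apply: fz.
have Bx : {in V, forall y, M (f y) (f x) = A x y || (y == c)}.
  by move=> y yV; rewrite -AA // BA // eqxx symA (negPf xc) andbF andbT.
(* Only the edge to [c] moves to the new vertex. *)
pose bb n := n == f c.
pose M' p q := [|| [&& p \in N, q \in N, M p q, p != f x & q != f x],
                    [&& p == f x, q \in N, M q (f x) & (q \in [:: f a; f b]) || ~~ bb q],
                    [&& q == f x, p \in N, M p (f x) & (p \in [:: f a; f b]) || ~~ bb p],
                    [&& p == z, q \in N & (q \in [:: f a; f b]) || M q (f x) && bb q]
                  | [&& q == z, p \in N & (p \in [:: f a; f b]) || M p (f x) && bb p]].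
have nbr : {in V, forall y, (A x y || (y == c)) && ((y == a) || (y == b) || (y != c)) = A x y}.
  move=> y yV; case: (eqVneq y c) => [->|_]; last by rewrite !orbT andbT orbF.
  by case: (eqVneq c a) Axc => [->|_]; rewrite ?Axa //; case: (eqVneq c b) => [->|_]; rewrite ?Axb //= orbT andbF => /negPf ->.
have nbv : {in V, forall y, (y == a) || (y == b) || (A x y || (y == c)) && (y == c) = A v y}.
  by move=> y yV; rewrite Av // -orbA; case: (y == c); rewrite ?orbT ?andbF.
apply: (@realizable_extend _ B A v N M f z M') => //.
- apply: constr_move cN _; apply: Or44; exists z, (f x), (f a), (f b), bb.
  split=> //; first by rewrite !fV.
  by rewrite feq // ab -!AA // !BA // Axa Axb.
- move=> y w yV wV; rewrite /M' /bb !inE !fV // !fz // !Bx // !feq // !andFb !orbF !andTb !nbr //.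
  rewrite -AA // BA //.
  case: (eqVneq y x) => [->|yx] /=; first by rewrite andbF irrA andbF orbF.
  case: (eqVneq w x) => [->|wx] /=; first by rewrite andbF symA.
  by rewrite andbF andbT !orbF.
- by move=> y yV; rewrite /M' /bb !inE (negPf zN) eqxx !fz // !zf // !fV // !Bx // !feq // !andbF !orbF !andTb nbv.
- by move=> y yV; rewrite /M' /bb !inE (negPf zN) eqxx !fz // !zf // !fV // !Bx // !feq // !andbF !andTb nbv.
by rewrite /M' (negPf zN) !andbF.
Qed.

(** If at most one element of [K] satisfies [p], then [find] locates it. This matches adjacency to
    the K4 with the choice function of the move. *)
Lemma find_count_le1 (p : pred I) K k : count p K <= 1 -> k \in K ->
  p k = has p K && (index k K == find p K).
Proof.
elim: K => //= h K IH; rewrite in_cons [k == h]eq_sym.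
case ph: (p h) => /=; last first.
  case: eqP => [<-|_] /= cK kK; first by rewrite ph andbF.
  by rewrite eqSS -IH.
case: eqP => [<- _ _|_ cK kK] /=; first by rewrite ph.
apply/negP => pk; have : has p K by apply/hasP; exists k.
by rewrite has_count; case: (count p K) cK.
Qed.

(* Unlike in [vertex_to_K4], where the four new names are fresh, [u] may itself
   belong to [K]. *)
Lemma realizable_K4 R A B u K :
  symmetric A -> realizable (u :: R) B -> u \notin R -> size K = 4 -> uniq (K ++ R) ->
  {in R &, A =2 B} -> ~~ B u u -> {in R, forall x, B x u = has (A x) K} ->
  {in R, forall x, count (A x) K <= 1} -> {in K &, forall x y, A x y = (x != y)} ->
  realizable (K ++ R) A.
Proof.
move=> symA [N [M [f rN]]] uR sK; rewrite cat_uniq => /and3P[uK /hasPn KR uniqR] AB Buu Bu le1 AK.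
have [cN injf mN BM] := rN.
have [z zN] := exists_fresh N.
have uV : u \in u :: R by apply: mem_head.
have RV x : x \in R -> x \in u :: R by rewrite in_cons orbC => ->.
have fV := realized_mem rN; have feq := realized_eq rN.
pose W := iota z 4.
have WN n : n \in W -> (n \in N) = false by rewrite mem_iota => /andP[/zN/negPf].
have NW n : n \in N -> (n \in W) = false by move=> nN; apply: contraTF nN => /WN ->.
(* The name [n] is decoded to a vertex of [R], and the position of its neighbour in [K] is taken.
   The default [u] is not reached for names of vertices in [R]. *)
pose nbr n := find (A (nth u R (index n (map f R)))) K.
have nbrE x : x \in R -> nbr (f x) = find (A x) K.
  move=> xR; rewrite /nbr; set i := index _ _.
  have iR : i < size R by rewrite -(size_map f) index_mem map_f.
  suff -> : nth u R i = x by [].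
  apply: injf; rewrite ?RV ?mem_nth //.
  by rewrite -(nth_map u (f u)) // nth_index ?map_f.
pose col n := z + nbr n.
pose M' p q := [|| [&& p \in N, q \in N & M p q],
                   [&& p \in N, q \in W, M p (f u) & col p == q],
                   [&& p \in W, q \in N, M q (f u) & col q == p]
                 | [&& p \in W, q \in W & p != q]].
(* Membership in [K] is tested first, so if [u] lies in [K] its old name [f u] gives way to a fresh
   one. *)
pose g x := if x \in K then z + index x K else f x.
have gK x : x \in K -> g x = z + index x K by rewrite /g => ->.
have gR x : x \in R -> g x = f x by move=> /KR; rewrite /g => /negPf ->.
have gW x : x \in K -> g x \in W.
  by move=> xK; rewrite gK // mem_iota leq_addr ltn_add2l -sK index_mem.
have gN x : x \in R -> g x \in N by move=> xR; rewrite gR // fV // RV.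
have Mu x : x \in R -> M (f x) (f u) = has (A x) K by move=> xR; rewrite -BM ?Bu // RV.
have gKeq x y : x \in K -> y \in K -> (g x == g y) = (x == y).
  by move=> xK yK; rewrite !gK // eqn_add2l; apply/eqP/eqP => [/index_inj|->] //; apply.
exists (W ++ filter (predC1 (f u)) N), M', g; split.
- apply: constr_move cN _; apply: Or43.
  exists (f u), z, z.+1, z.+2, z.+3, col; split=> //; first exact: fV.
  + by apply/andP; split; [exact: (iota_uniq z 4) | apply/allP => n /WN ->].
  + move=> n nN Mn; rewrite -/(iota z 4) mem_iota leq_addr ltn_add2l /=.
    move: nN Mn; rewrite mN => /mapP[x + ->]; rewrite in_cons => /orP[/eqP->|xR].
      by rewrite -BM // (negPf Buu).
    by rewrite Mu // /col nbrE // has_find sK.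
- move=> x y; rewrite !mem_cat => /orP[xK|xR] /orP[yK|yR].
  + by move/eqP; rewrite gKeq // => /eqP.
  + by move=> gxy; have := gW _ xK; rewrite gxy => /WN; rewrite gN.
  + by move=> gxy; have := gW _ yK; rewrite -gxy => /WN; rewrite gN.
  + by rewrite !gR //; apply: injf; apply: RV.
- move=> n; rewrite map_cat !mem_cat; congr (_ || _).
    have /eq_in_map -> : {in K, g =1 fun x => z + index x K} by apply: gK.
    have -> : W = map (addn z) (iota 0 4) by rewrite -iotaDl addn0.
    apply/mapP/mapP => -[k]; [rewrite mem_iota -sK => /= kK | move=> kK] => ->.
      by exists (nth u K k); rewrite ?mem_nth // index_uniq.
    by exists (index k K); rewrite // mem_iota -sK index_mem.
  have -> : map g R = map f R by apply/eq_in_map.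
  rewrite mem_filter mN /= in_cons; case: eqP => [->|] //=.
  by apply/esym/negbTE/mapP => -[x xR /eqP]; rewrite feq ?(RV x) // => /eqP ux; rewrite ux xR in uR.
move=> x y; rewrite !mem_cat /M' => /orP[xK|xR] /orP[yK|yR].
- by rewrite !gW // !(WN _ (gW _ _)) //= gKeq // AK.
- rewrite (WN _ (gW _ xK)) (NW _ (gN _ yR)) gW // gN //= orbF gR // Mu // /col nbrE //.
  by rewrite symA (find_count_le1 (le1 _ yR) xK) gK // eqn_add2l [find _ _ == _]eq_sym.
- rewrite (WN _ (gW _ yK)) (NW _ (gN _ xR)) gW // gN //= !orbF gR // Mu // /col nbrE //.
  by rewrite (find_count_le1 (le1 _ xR) yK) gK // eqn_add2l [find _ _ == _]eq_sym.
by rewrite !gN // !(NW _ (gN _ _)) //= !orbF AB // !gR // BM // RV.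
Qed.

End Realization.

(** * Inverse moves *)

Lemma size_leq_count (I : eqType) (p : pred I) s t :
  uniq t -> {subset t <= s} -> all p t -> size t <= count p s.
Proof.
move=> ut ts /allP pt; rewrite -size_filter uniq_leq_size // => x xt.
by rewrite mem_filter ts // pt.
Qed.

(** * Tight vertex sets and the reductions they allow *)

Section Reduction.
Variable T : finType.
Implicit Types (A B : rel T) (U V R s t : seq T) (a b c v x y : T).

(* The sets on which the sparsity bound of [V] is attained. *)
Definition tset V A s := [/\ uniq s, {subset s <= V} & nedges A s + 2 = 2 * size s].

Lemma sparse_tail v U A : sparse (v :: U) A -> sparse U A.
Proof. by move=> sp s us sU; apply: sp => // x /sU xU; rewrite in_cons xU orbT. Qed.

(** Adding [v] to a set that attains its bound leaves room for only two more edges. *)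
Lemma tset_nbrs_le2 V A s v t : sparse V A -> tset V A s -> v \in V -> v \notin s ->
  uniq t -> {subset t <= s} -> all (A v) t -> size t <= 2.
Proof.
move=> sp [us sV eqs] vV vs ut ts At; have := size_leq_count ut ts At.
have : nedges A (v :: s) + 2 <= 2 * size (v :: s).
  by apply: sp => //=; [rewrite vs | move=> x; rewrite in_cons => /orP[/eqP->|/sV]].
by move: eqs; rewrite /=; clear; lia.
Qed.

(** The edges to [a] and [b] use up the two units that [v] adds to the bound, and sparsity excludes
    further ones. *)
Lemma tset_cons V A s v a b : sparse V A -> tset V A s -> v \in V -> v \notin s ->
  a \in s -> b \in s -> a != b -> A v a -> A v b -> tset V A (v :: s).
Proof.
move=> sp [us sV eqs] vV vs as_ bs ab Ava Avb.
have vsV : {subset v :: s <= V} by move=> x; rewrite in_cons => /orP[/eqP->|/sV].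
split=> //=; first by rewrite vs.
have : 2 <= count (A v) s.
  apply: (@size_leq_count _ _ _ [:: a; b]); rewrite /= ?inE ?ab ?Ava //.
    by move=> x; rewrite !inE => /orP[] /eqP->.
  by rewrite Avb.
have : nedges A (v :: s) + 2 <= 2 * size (v :: s) by apply: sp => //=; rewrite vs.
by move: eqs; rewrite /=; clear; lia.
Qed.

(** Supermodularity of the edge count: union and intersection together induce at least as many edges
    as [s] and [t], the excess being the edges between [s'] and [t']. The intersection contains [a],
    so sparsity bounds it, which forces the union to attain its bound. *)
Lemma tset_union V A s t a : symmetric A -> irreflexive A -> sparse V A ->
  tset V A s -> tset V A t -> a \in s -> a \in t ->
  exists r, [/\ tset V A r, {subset s <= r} & {subset t <= r}].
Proof.
move=> symA irrA sp [us sV eqs] [ut tV eqt] as_ at_.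
pose i := filter (mem t) s; pose s' := filter (predC (mem t)) s.
pose t' := filter (predC (mem s)) t.
have ps : perm_eq s (i ++ s') by rewrite perm_sym perm_filterC.
have pt : perm_eq t (i ++ t').
  apply: perm_trans (_ : perm_eq (filter (mem s) t ++ t') _).
    by rewrite perm_sym perm_filterC.
  rewrite perm_cat2r uniq_perm ?filter_uniq // => x.
  by rewrite !mem_filter andbC.
have ui : uniq i by apply: filter_uniq.
have iV : {subset i <= V} by move=> x; rewrite mem_filter => /andP[_ /sV].
have ai : a \in i by rewrite mem_filter /= at_.
have := sp i ui iV; have -> : i != [::] by case: (i) ai.
have nperm r r' : perm_eq r r' -> nedges A r = nedges A r' by apply: nedges_perm.
have memr x : (x \in s ++ t') = (x \in s) || (x \in t).
  by rewrite mem_cat mem_filter /=; case: (x \in s).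
have ur : uniq (s ++ t').
  rewrite cat_uniq us filter_uniq // andbT; apply/hasPn => x.
  by rewrite mem_filter => /andP[].
have rV : {subset s ++ t' <= V} by move=> x; rewrite memr => /orP[/sV|/tV].
move=> /(_ isT) leI; exists (s ++ t'); split; first 1 last.
- by move=> x xs; rewrite memr xs.
- by move=> x xt; rewrite memr xt orbT.
split=> //.
have := sp (s ++ t') ur rV; have -> : s ++ t' != [::] by case: (s) as_.
move=> /(_ isT).
move: eqs eqt leI; rewrite (nperm _ _ ps) (nperm _ _ pt) (perm_size ps) (perm_size pt).
rewrite (@nperm (s ++ t') ((i ++ s') ++ t')) ?perm_cat2r //.
rewrite !size_cat (perm_size ps) size_cat !nedges_cat.
have -> : cross A (i ++ s') t' = cross A i t' + cross A s' t' by rewrite /cross big_cat.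
move: (nedges A i) (nedges A s') (nedges A t') (cross A i s') (cross A i t') (cross A s' t').
by move: (size i) (size s') (size t'); clear; lia.
Qed.

(** Quantifying over finite sets makes this a boolean; [blockedP] gives the form with lists. *)
Definition blocked U A a b := [exists X : {set T},
  [&& X \subset U, a \in X, b \in X & nedges A (enum X) + 2 == 2 * #|X|]].

Lemma blockedP U A a b : symmetric A -> irreflexive A ->
  reflect (exists s, [/\ tset U A s, a \in s & b \in s]) (blocked U A a b).
Proof.
move=> symA irrA; apply: (iffP existsP) => [[X /and4P[/subsetP XU aX bX /eqP eqX]]|].
  exists (enum X); rewrite !mem_enum; split=> //; split; first exact: enum_uniq.
    by move=> x; rewrite mem_enum => /XU.
  by rewrite eqX cardE.
move=> [s [[us sU eqs] as_ bs]]; exists [set x in s].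
have ps : perm_eq (enum [set x in s]) s.
  by rewrite uniq_perm ?enum_uniq // => x; rewrite mem_enum inE.
rewrite !inE as_ bs cardE (perm_size ps) (nedges_perm _ _ ps) // eqs eqxx !andbT.
by apply/subsetP => x; rewrite inE => /sU.
Qed.

Definition add_edge A a b : rel T :=
  fun x y => A x y || ((x == a) && (y == b) || (x == b) && (y == a)).

Lemma add_edge_sym A a b : symmetric A -> symmetric (add_edge A a b).
Proof.
by move=> symA x y; rewrite /add_edge symA orbC [in RHS]orbC; congr (_ || _);
  rewrite orbC; congr (_ || _); apply: andbC.
Qed.

Lemma add_edge_irr A a b : a != b -> irreflexive A -> irreflexive (add_edge A a b).
Proof.
move=> ab irrA x; rewrite /add_edge irrA /=.
by case: eqP => [->|_] /=; rewrite ?(negPf ab) ?andbF.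
Qed.

(* Covers both the inverse Henneberg 2 move and the inverse 4-cycle move at a
   vertex of degree 3. *)
Lemma tight_swap_vertex_edge U A v a b : symmetric A -> irreflexive A ->
  tight (v :: U) A -> count (A v) U = 3 -> a \in U -> b \in U -> a != b ->
  ~~ A a b -> ~~ blocked U A a b -> tight U (add_edge A a b).
Proof.
move=> symA irrA [/= /andP[vU uU] _ _ sp eqV] d3 aU bU ab Aab nb.
have Aba : ~~ A b a by rewrite symA.
have nE s : uniq s -> nedges (add_edge A a b) s = nedges A s + (a \in s) && (b \in s).
  by move=> us; apply: nedges_add_edge.
split=> //.
- by move=> x y _ _; apply: add_edge_sym.
- by move=> x _; apply: add_edge_irr.
- move=> s us sU s0; rewrite nE //; have := sparse_tail sp us sU s0.
  case as_: (a \in s); last by clear; lia.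
  case bs: (b \in s); last by clear; lia.
  (* A set containing both ends has room for the new edge, since otherwise it would block the
     pair. *)
  have : nedges A s + 2 != 2 * size s.
    by apply: contra nb => /eqP eqs; apply/blockedP => //; exists s.
  by clear; rewrite /=; lia.
by move: eqV; rewrite nE // aU bU d3 /=; clear; lia.
Qed.

(** No tight set inside [U] contains [a], [b] and [c], because [v] has all three as neighbours. If a
    second pair is blocked, the union of the two blocking sets is such a set; if [c] is adjacent to
    both [a] and [b], adding [c] to the set blocking [a] and [b] gives one. *)
Lemma not_all_blocked U A v a b c : symmetric A -> irreflexive A ->
  tight (v :: U) A -> a != b -> a != c -> b != c ->
  A v a -> A v b -> A v c -> c \in U ->
  blocked U A a b -> A a c || blocked U A a c -> A b c || blocked U A b c -> False.
Proof.
move=> symA irrA [/= /andP[vU uU] _ _ sp _] ab ac bc Ava Avb Avc cU.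
have spU := sparse_tail sp.
have no3 s : tset U A s -> a \in s -> b \in s -> c \in s -> False.
  move=> [us sU eqs] as_ bs cs.
  suff : size [:: a; b; c] <= 2 by [].
  apply: (tset_nbrs_le2 (v := v) (s := s) sp); first 1 last.
  - exact: mem_head.
  - by apply: contra vU => /sU.
  - by rewrite /= !inE negb_or ab ac bc.
  - by move=> x; rewrite !inE => /or3P[] /eqP->.
  - by rewrite /= Ava Avb Avc.
  by split=> // x /sU xU; rewrite in_cons xU orbT.
have nbc p : blocked U A a b -> blocked U A p c -> p \in [:: a; b] -> False.
  move=> /blockedP[] // s [ts as_ bs] /blockedP[] // t [tt pt ct] pab.
  have ps : p \in s by move: pab; rewrite !inE => /orP[] /eqP->.
  have [r [tr sr tr']] := tset_union symA irrA spU ts tt ps pt.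
  by apply: (no3 r) => //; [apply: sr | apply: sr | apply: tr'].
move=> bab /orP[Aac|bac] /orP[Abc|bbc].
- have /blockedP[] // := bab => s [ts as_ bs].
  case: (boolP (c \in s)) => cs; first exact: no3 cs.
  have tcs := tset_cons spU ts cU cs as_ bs ab.
  have {}tcs : tset U A (c :: s) by apply: tcs; rewrite symA.
  by apply: no3 tcs _ _ _; rewrite in_cons ?as_ ?bs ?eqxx ?orbT.
- by apply: nbc bab bbc _; rewrite !inE eqxx orbT.
- by apply: nbc bab bac _; rewrite !inE eqxx.
- by apply: nbc bab bac _; rewrite !inE eqxx.
Qed.

(** These two facts are what is needed for deleting [v] and adding the edge between [x] and [c] to
    preserve tightness. *)
Lemma K4_outer_unblocked U A v a b c x : symmetric A -> irreflexive A ->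
  tight (v :: U) A -> uniq [:: a; b; c; x] -> {subset [:: a; b; c; x] <= U} ->
  A v a -> A v b -> A v c -> A a b -> A a c -> A b c -> A x a -> A x b ->
  ~~ A x c /\ ~~ blocked U A x c.
Proof.
move=> symA irrA [/= /andP[vU uU] _ _ sp _] uabcx sU Ava Avb Avc Aab Aac Abc Axa Axb.
have [aU bU cU xU] : [/\ a \in U, b \in U, c \in U & x \in U].
  by split; apply: sU; rewrite !inE eqxx ?orbT.
move: uabcx; rewrite /= !inE !negb_or => /and4P[/and3P[ab ac ax] /andP[bc bx] cx _].
have spU := sparse_tail sp.
have wV y : y \in U -> y \in v :: U by rewrite in_cons orbC => ->.
have vn y : y \in U -> v != y by move=> yU; apply: contraNneq vU => ->.
split.
  apply/negP => Axc.
  (* The K4 and three edges from [x] would put 9 edges on 5 vertices, where 8 is the maximum. *)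
  have : nedges A [:: x; v; a; b; c] + 2 <= 2 * size [:: x; v; a; b; c].
    apply: sp => //; last by move=> y; rewrite !inE => /or4P[/eqP->|/eqP->|/eqP->|/orP[]/eqP->]; rewrite ?eqxx ?aU ?bU ?cU ?xU ?orbT.
    rewrite /= !inE !negb_or ab ac bc !vn // [x == v]eq_sym vn // ![x == _]eq_sym.
    by rewrite ax bx cx.
  by rewrite /= Axa Axb Axc Ava Avb Avc Aab Aac Abc; case: (A x v).
apply/negP => /blockedP[] // s [ts xs cs].
have no3 t y p q r : tset U A t -> y \in v :: U -> y \notin t -> uniq [:: p; q; r] ->
    p \in t -> q \in t -> r \in t -> A y p -> A y q -> A y r -> False.
  move=> [ut tU eqt] yV yt upqr pt qt rt Ap Aq Ar.
  suff : size [:: p; q; r] <= 2 by [].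
  apply: (tset_nbrs_le2 (v := y) (s := t) sp) => //.
  - by split=> // z /tU zU; rewrite in_cons zU orbT.
  - by move=> z; rewrite !inE => /or3P[] /eqP->.
  - by rewrite /= Ap Aq Ar.
have tU t y : tset U A t -> y \notin U -> y \notin t.
  by move=> [_ tU _]; apply: contra => /tU.
(* [a] is adjacent to both [x] and [c], so it can be added to the blocking set. *)
have [t [tt st at_]] : exists t, [/\ tset U A t, {subset s <= t} & a \in t].
  case: (boolP (a \in s)) => as_; first by exists s; split.
  exists (a :: s); split; last exact: mem_head.
    by apply: (tset_cons spU ts aU as_ xs cs) => //; rewrite 1?symA // eq_sym.
  by move=> y ys; rewrite in_cons ys orbT.
have [xt ct] : x \in t /\ c \in t by split; apply: st.
(* If [b] lies in [t], then [v] has the three neighbours [a], [b], [c] there; if not, [b] has the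
   three neighbours [x], [c], [a] there. *)
case: (boolP (b \in t)) => bt.
  have vt : v \notin t by apply: tU tt vU.
  have uabc : uniq [:: a; b; c] by rewrite /= !inE negb_or ab ac bc.
  exact: (no3 t v a b c tt (mem_head _ _) vt uabc).
have uxca : uniq [:: x; c; a].
  by rewrite /= !inE negb_or [x == a]eq_sym [c == a]eq_sym ax ac [x == c]eq_sym cx.
by apply: (no3 t b x c a tt (wV b bU) bt uxca); rewrite // symA.
Qed.

(* The contracted K4 is represented by its own vertex [v]. *)
Definition contract K v A : rel T := fun x y =>
  if x == v then (y != v) && has (A y) K else if y == v then has (A x) K else A x y.

(** No two edges merge, because an outer vertex has at most one neighbour in [K]. A set through the
    contracted vertex expands to one with 6 more edges and 3 more vertices, which leaves the
    difference in the bound unchanged. *)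
Lemma contract_tight K R v A : symmetric A -> irreflexive A -> v \in K -> size K = 4 ->
  tight (K ++ R) A -> {in K &, forall x y, A x y = (x != y)} ->
  {in R, forall x, count (A x) K <= 1} -> tight (v :: R) (contract K v A).
Proof.
move=> symA irrA vK sK [uKR _ _ sp eqV] AK le1.
move: (uKR); rewrite cat_uniq => /and3P[uK /hasPn KR uR].
have vR : v \notin R by apply: contraL vK => /KR.
have Rv x : x \in R -> (x == v) = false by move=> xR; apply: mem_neq xR vR.
have nE s : {subset s <= R} -> nedges (contract K v A) s = nedges A s.
  move=> sR; apply: eq_in_nedges => x y /sR xR /sR yR.
  by rewrite /contract !Rv.
have cE s : {subset s <= R} -> count (contract K v A v) s = cross A s K.
  move=> sR; rewrite count_sum; apply: eq_big_seq => x /sR xR.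
  rewrite /contract eqxx Rv //= has_count.
  by move: (le1 x xR); case: (count _ _) => [|[]].
have sKs s : nedges A (s ++ K) = nedges A s + 6 + cross A s K.
  rewrite nedges_cat; congr (_ + _ + _).
  by have := nedges_complete uK AK; rewrite sK; clear; lia.
apply: tight_cons.
- by rewrite /= vR.
- move=> x y _ _; rewrite /contract; case: (eqVneq x v) => [->|_].
    by case: (eqVneq y v).
  by case: (eqVneq y v) => //= _; apply: symA.
- by move=> x _; rewrite /contract; case: (eqVneq x v).
- move=> s us sR s0; rewrite nE //; apply: sp => // x /sR xR.
  by rewrite mem_cat xR orbT.
- move=> s us sR s0; rewrite nE // cE //.
  have : nedges A (s ++ K) + 2 <= 2 * size (s ++ K).
    apply: sp; last by case: (s) s0.
      rewrite cat_uniq us uK andbT; apply/hasPn => x xK.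
      by apply: contraL xK => /sR/KR.
    by move=> x; rewrite !mem_cat => /orP[/sR->|->]; rewrite ?orbT.
  by rewrite sKs size_cat sK; clear; lia.
have pKR : perm_eq (K ++ R) (R ++ K) by rewrite perm_catC.
rewrite nE // cE //; move: eqV.
by rewrite (nedges_perm _ _ pKR) // sKs size_cat sK; clear; lia.
Qed.

Lemma tight_delete2 U A v : tight (v :: U) A -> count (A v) U = 2 -> tight U A.
Proof.
move=> [/= /andP[vU uU] symA irrA sp eqV] d2; split=> //.
- by move=> x y xU yU; apply: symA; rewrite in_cons ?xU ?yU orbT.
- by move=> x xU; apply: irrA; rewrite in_cons xU orbT.
- exact: sparse_tail sp.
by move: eqV; rewrite d2; move: (nedges A U) (size U); clear; lia.
Qed.

(** The degree sum is [4 * size V - 4], so some degree is at most 3. A vertex of degree below 2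
    would leave a nonempty rest with too many edges. *)
Lemma exists_low_degree V A : symmetric A -> irreflexive A -> tight V A -> 1 < size V ->
  exists2 v, v \in V & 2 <= count (A v) V <= 3.
Proof.
move=> symA irrA tV n1; have [uV _ _ _ eqV] := tV.
have /hasP[v vV d3] : has (fun v => count (A v) V <= 3) V.
  apply: contraT => /hasPn d4.
  have : \sum_(x <- V) 4 <= \sum_(x <- V) count (A x) V.
    by apply: leq_in_sum => x /d4; rewrite -ltnNge.
  rewrite handshake // big_const_seq count_predT iter_addn_0.
  by move: eqV; move: (nedges A V) (size V); clear; lia.
exists v => //; rewrite d3 andbT.
have pV := perm_to_rem vV; have [/= _ _ _ sp eqV'] := tight_perm pV tV.
rewrite (permP pV) /= irrA add0n.
have := sparse_tail sp (rem_uniq v uV) (fun x => id).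
have := perm_size pV; rewrite /=.
have : rem v V != [::] by rewrite -size_eq0 size_rem //; move: n1; clear; case: (size V) => [|[]].
move=> -> sr /(_ isT); move: eqV'.
by move: (nedges A (rem v V)) (size (rem v V)) (count (A v) (rem v V)); clear; lia.
Qed.

End Reduction.

(** * Every tight graph is constructible *)

Section Completeness.
Variable T : finType.
Implicit Types (A B : rel T) (U V R s t : seq T) (a b c v x y : T).

Lemma blockedC U A a b : blocked U A a b = blocked U A b a.
Proof. by apply: eq_existsb => X; congr (_ && _); apply: andbCA. Qed.

(** The induction is on a bound for the size, since contracting a K4 removes three vertices at
    once. *)
Lemma tight_realizable n V A : size V <= n -> symmetric A -> irreflexive A ->
  tight V A -> realizable V A.
Proof.
elim: n V A => [|n IH] V A; first by case: V => // _ _ _ [].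
move=> sV symA irrA tV; case: (ltnP 1 (size V)) => [n1|]; last first.
  by case: V tV {sV} => [[]|v [|w V]] // _ _; apply: realizable1.
have [v vV] := exists_low_degree symA irrA tV n1.
have pV := perm_to_rem vV; move: (rem v V) pV => U pV.
rewrite (permP pV) /= irrA add0n => deg_v.
suff: realizable (v :: U) A by apply: realizable_perm => x; rewrite (perm_mem pV).
have {tV} tV := tight_perm pV tV.
have {sV} sU : size U <= n by move: sV; rewrite (perm_size pV).
have [/= /andP[vU uU] _ _ sp _] := tV.
have uN : uniq (filter (A v) U) by apply: filter_uniq.
have memN : {in U, forall y, A v y = (y \in filter (A v) U)}.
  by move=> y yU; rewrite mem_filter yU andbT.
have NU : {subset filter (A v) U <= U} by move=> y; rewrite mem_filter => /andP[].
have : count (A v) U = 2 \/ count (A v) U = 3.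
  by move: deg_v; case: (count _ _) => [|[|[|[|[]]]]]; auto.
case=> [d2|d3].
  have rU := IH _ _ sU symA irrA (tight_delete2 tV d2).
  move: d2 uN memN NU; rewrite -size_filter.
  case: (filter _ _) => [|a [|b []]] //= _; rewrite inE andbT => ab memN NU.
  apply: (realizable_henneberg1 (a := a) (b := b)) => //.
  - by apply: NU; rewrite !inE eqxx.
  - by apply: NU; rewrite !inE eqxx orbT.
  - by move=> y /memN; rewrite !inE.
have := d3; move: uN memN NU; rewrite -size_filter.
case: (filter _ _) => [|a [|b [|c []]]] //= + + + _.
rewrite !inE !negb_or => /and3P[/andP[ab ac] bc _] memN NU.
have [aU bU cU] : [/\ a \in U, b \in U & c \in U].
  by split; apply: NU; rewrite !inE eqxx ?orbT.
have {NU} Av : {in U, forall y, A v y = [|| y == a, y == b | y == c]}.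
  by move=> y /memN; rewrite !inE.
have [Ava Avb Avc] : [/\ A v a, A v b & A v c] by rewrite !Av // !eqxx ?orbT.
(* The two obstructions to adding the edge between [p] and [q] once [v] is deleted. *)
pose bad p q := A p q || blocked U A p q.
have badC p q : bad p q = bad q p by rewrite /bad symA blockedC.
have swap p q : p \in U -> q \in U -> p != q -> ~~ A p q -> ~~ blocked U A p q ->
    realizable U (add_edge A p q).
  move=> pU qU pq Apq npq; apply: IH => //; first exact: add_edge_sym.
    exact: add_edge_irr.
  exact: tight_swap_vertex_edge tV d3 _ _ _ _ _.
have H2 p q r : [&& p \in U, q \in U, r \in U, p != q, p != r & q != r] ->
    {in U, forall y, A v y = [|| y == p, y == q | y == r]} -> ~~ bad p q ->
    realizable (v :: U) A.
  move=> pqr Avpqr; rewrite negb_or => /andP[Apq npq].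
  have /and4P[pU qU rU /andP[pq _]] := pqr.
  by apply: realizable_henneberg2 (swap _ _ pU qU pq Apq npq) vU pqr Apq _ Avpqr.
have [ba ca cb] : [/\ b != a, c != a & c != b] by split; rewrite eq_sym.
case: (boolP (bad a b)) => [bad_ab|]; last first.
  by apply: (H2 a b c) => //; rewrite aU bU cU ab ac bc.
case: (boolP (bad a c)) => [bad_ac|]; last first.
  apply: (H2 a c b); first by rewrite aU bU cU ab ac cb.
  by move=> y yU; rewrite Av //; congr (_ || _); apply: orbC.
case: (boolP (bad b c)) => [bad_bc|]; last first.
  apply: (H2 b c a); first by rewrite aU bU cU ba ca bc.
  by move=> y yU; rewrite Av // orbC -orbA.
(* Now all three pairs are bad. By [not_all_blocked] none of them can be bad through blocking alone,
   so all are edges and [v], [a], [b], [c] form a K4. *)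
have Aab : A a b.
  case/orP: (bad_ab) => // blk.
  by case: (not_all_blocked symA irrA tV ab ac bc Ava Avb Avc cU blk bad_ac bad_bc).
have Aac : A a c.
  case/orP: (bad_ac) => // blk; rewrite badC in bad_bc.
  by case: (not_all_blocked symA irrA tV ac ab cb Ava Avc Avb bU blk bad_ab bad_bc).
have Abc : A b c.
  case/orP: (bad_bc) => // blk; rewrite badC in bad_ab; rewrite badC in bad_ac.
  by case: (not_all_blocked symA irrA tV bc ba ca Avb Avc Ava aU blk bad_ab bad_ac).
pose R := filter (predC (mem [:: a; b; c])) U.
have RU x : x \in R -> [/\ x \in U, x != a, x != b & x != c].
  by rewrite mem_filter /= !inE !negb_or => /andP[/and3P[-> -> ->] ->].
(* The inverse 4-cycle move: [x] shares the neighbours [p] and [q] with [v] and takes over the edge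
   to [r]. *)
have cyc x p q r : x \in R -> uniq [:: p; q; r; x] -> {subset [:: p; q; r; x] <= U} ->
    {in U, forall y, A v y = [|| y == p, y == q | y == r]} ->
    A p q -> A p r -> A q r -> A x p -> A x q -> realizable (v :: U) A.
  move=> xR upqrx sub Avpqr Apq Apr Aqr Axp Axq.
  have [pU qU rU xU] : [/\ p \in U, q \in U, r \in U & x \in U].
    by split; apply: sub; rewrite !inE eqxx ?orbT.
  have [Avp Avq Avr] : [/\ A v p, A v q & A v r] by rewrite !Avpqr // !eqxx ?orbT.
  have [Axr nxr] := K4_outer_unblocked symA irrA tV upqrx sub Avp Avq Avr Apq Apr Aqr Axp Axq.
  move: upqrx; rewrite /= !inE !negb_or => /and4P[/and3P[pq _ _] _ rx _].
  have xr : x != r by rewrite eq_sym.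
  apply: (realizable_4cycle (x := x) (a := p) (b := q) (c := r) symA irrA (swap _ _ xU rU xr Axr nxr)) => //.
    by rewrite xU pU qU rU.
  by rewrite pq xr Axp Axq.
(* Either an outer vertex has two neighbours in the K4, and [cyc] applies, or none has and the K4
   can be contracted. *)
case: (boolP (has (fun x => 1 < count (A x) [:: a; b; c]) R)) => [/hasP[x xR]|/hasPn le1].
  have [xU xa xb xc] := RU x xR.
  have [ax bx cx] : [/\ a != x, b != x & c != x] by split; rewrite eq_sym.
  have sub p q r : [&& p \in U, q \in U & r \in U] -> {subset [:: p; q; r; x] <= U}.
    by move=> /and3P[pU qU rU] y; rewrite !inE => /or4P[] /eqP->.
  have [Aba Aca Acb] : [/\ A b a, A c a & A c b] by split; rewrite symA.
  rewrite /=; case Axa: (A x a); case Axb: (A x b); case Axc: (A x c) => // _.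
  - apply: (cyc x a b c) => //; last by apply: sub; rewrite aU bU cU.
    by rewrite /= !inE !negb_or ab ac ax bc bx cx.
  - apply: (cyc x a b c) => //; last by apply: sub; rewrite aU bU cU.
    by rewrite /= !inE !negb_or ab ac ax bc bx cx.
  - apply: (cyc x a c b) => //; first 1 last.
    + by apply: sub; rewrite aU bU cU.
    + by move=> y yU; rewrite Av //; congr (_ || _); apply: orbC.
    by rewrite /= !inE !negb_or ab ac ax cb bx cx.
  - apply: (cyc x b c a) => //; first 1 last.
    + by apply: sub; rewrite aU bU cU.
    + by move=> y yU; rewrite Av // orbC -orbA.
    by rewrite /= !inE !negb_or ba ca ax bc bx cx.
pose K := [:: v; a; b; c].
have [va vb vc] : [/\ v != a, v != b & v != c].
  by split; apply: contraNneq vU => ->.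
have vR : v \notin R by apply: contra vU => /RU[].
have vK : v \in K by apply: mem_head.
have uabc : uniq [:: a; b; c] by rewrite /= !inE negb_or ab ac bc.
have pKR : perm_eq (v :: U) (K ++ R).
  rewrite (_ : K ++ R = v :: ([:: a; b; c] ++ R)) // perm_cons.
  apply: (@perm_trans _ (filter (mem [:: a; b; c]) U ++ R)).
    by rewrite perm_sym perm_filterC.
  rewrite perm_cat2r.
  rewrite uniq_perm ?filter_uniq // => x; rewrite mem_filter /= !inE.
  by case: eqP => [->|_]; [rewrite aU | case: eqP => [->|_]; [rewrite bU | case: eqP => [->|_]; rewrite ?cU]].
have tKR := tight_perm pKR tV.
have le1K : {in R, forall x, count (A x) K <= 1}.
  move=> x xR; have [xU xa xb xc] := RU x xR.
  have := le1 x xR; rewrite -leqNgt /= [A x v]symA Av // (negPf xa) (negPf xb) (negPf xc).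
  by rewrite add0n.
have AK : {in K &, forall x y, A x y = (x != y)}.
  have [Aba Aca Acb] : [/\ A b a, A c a & A c b] by split; rewrite symA.
  have [Aav Abv Acv] : [/\ A a v, A b v & A c v] by split; rewrite symA.
  have [av bv cv] : [/\ a != v, b != v & c != v] by split; rewrite eq_sym.
  by move=> x y; rewrite !inE => /or4P[] /eqP-> /or4P[] /eqP->; rewrite ?(irrA, eqxx) //;
    rewrite ?(Ava, Avb, Avc, Aav, Abv, Acv, Aab, Aac, Abc, Aba, Aca, Acb)
            ?(va, vb, vc, av, bv, cv, ab, ac, bc, ba, ca, cb).
have tC := contract_tight symA irrA vK (erefl _) tKR AK le1K.
suff : realizable (K ++ R) A by apply: realizable_perm => x; rewrite (perm_mem pKR).
have [uKR _ _ _ _] := tKR.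
apply: (@realizable_K4 _ R A (contract K v A) v K) => //.
- apply: IH tC.
  + by have := perm_size pKR; rewrite /= => -[sz]; move: sU; rewrite sz => /ltnW/ltnW.
  + move=> x y; rewrite /contract; case: (eqVneq x v) => [->|_].
      by case: (eqVneq y v).
    by case: (eqVneq y v) => //= _; apply: symA.
  + by move=> x; rewrite /contract; case: (eqVneq x v).
- by move=> x y xR yR; rewrite /contract !(mem_neq _ vR).
- by rewrite /contract eqxx.
by move=> x xR; rewrite /contract (mem_neq xR vR) eqxx.
Qed.

(** * Agreement of edge sets with edge counts *)

Variable e : rel T.
Hypotheses (syme : symmetric e) (irre : irreflexive e).

Lemma edgesP (f : {set T}) : reflect (exists x y, e x y /\ f = [set x; y]) (f \in edges e).
Proof.
apply: (iffP imset2P) => [[x y _]|[x [y [exy ->]]]].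
  by rewrite !inE /= => exy ->; exists x, y.
by exists x y; rewrite ?inE.
Qed.

(** Edges inside [v :: s] either lie inside [s] or join [v] to a neighbour in [s]. The two families
    are disjoint because [v] is not in [s]. *)
Lemma card_edges_in s : uniq s ->
  #|[set f in edges e | f \subset [set x in s]]| = nedges e s.
Proof.
elim: s => [|v s IH] /=.
  move=> _; apply: eq_card0 => f; rewrite !inE; apply/andP => -[/edgesP[x [y [_ ->]]]].
  by move/subsetP/(_ x); rewrite !inE eqxx => /(_ isT).
move=> /andP[vs us]; rewrite -(IH us) addnC.
pose S := [set y in s | e v y].
have -> : count (e v) s = #|[set [set v; y] | y in S]|.
  rewrite card_in_imset; last first.
    move=> y y'; rewrite !inE => /andP[ys _] _ /setP/(_ y).
    rewrite !inE eqxx orbT => /esym/orP[/eqP yv|/eqP//].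
    by rewrite yv (negPf vs) in ys.
  rewrite -size_filter -(card_uniqP (filter_uniq _ us)).
  by apply: eq_card => y; rewrite !inE mem_filter andbC.
have disj : [set f in edges e | f \subset [set x in s]] :&: [set [set v; y] | y in S] = set0.
  apply/setP => f; rewrite !inE; apply/negP => /andP[/andP[_ /subsetP fs] /imsetP[y _ fy]].
  by move: (fs v); rewrite fy !inE eqxx (negPf vs) => /(_ isT).
rewrite -cardsUI disj cards0 addn0; apply: eq_card => f; rewrite !inE; apply/andP/orP.
  move=> [/edgesP[x [y [exy ->]]] /subsetP fs].
  have := fs x; have := fs y; rewrite !inE !eqxx orbT => /(_ isT) ys /(_ isT) xs.
  case: (eqVneq x v) xs => [xv _|_ /= xs].
    right; apply/imsetP; exists y; last by rewrite xv.
    rewrite !inE -xv exy andbT; case/orP: ys => // /eqP yv.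
    by rewrite xv yv irre in exy.
  case: (eqVneq y v) ys => [yv _|_ /= ys].
    by right; apply/imsetP; exists x; rewrite ?inE ?xs -?yv 1?syme // setUC.
  left; apply/andP; split; first by apply/edgesP; exists x, y.
  by apply/subsetP => z; rewrite !inE => /orP[] /eqP->.
case=> [/andP[fe /subsetP fs]|/imsetP[y]].
  by split=> //; apply/subsetP => x /fs; rewrite !inE => ->; rewrite orbT.
rewrite !inE => /andP[ys evy] ->; split; first by apply/edgesP; exists v, y.
by apply/subsetP => z; rewrite !inE => /orP[] /eqP->; rewrite ?eqxx // ys orbT.
Qed.

Lemma card_edges : #|edges e| = nedges e (enum T).
Proof.
rewrite -card_edges_in ?enum_uniq //; apply: eq_card => f; rewrite inE.
have -> : [set x in enum T] = setT by apply/setP => x; rewrite !inE mem_enum.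
by rewrite subsetT andbT.
Qed.

Lemma tight2P : tight2 2 e <-> tight (enum T) e.
Proof.
split=> [[sp eqT]|[_ _ _ sp eqT]].
  split=> //; first exact: enum_uniq.
  - move=> s us _ s0; rewrite -card_edges_in //.
    set F := [set _ in _ | _]; have := sp [set x in s] F.
    have sF : subgraph e [set x in s] F.
      split; first by apply/subsetP => f; rewrite inE => /andP[].
      by move=> f; rewrite inE => /andP[].
    have -> : #|[set x in s]| = size s.
      by rewrite -(card_uniqP us); apply: eq_card => x; rewrite inE.
    (* [sparse2] says nothing about edgeless subgraphs; for these the bound only asks that [s] be
       nonempty. *)
    move=> /(_ sF); case: (eqVneq F set0) => [-> _|_ /(_ isT)//].
    by rewrite cards0; case: (s) s0 => // x s' _; rewrite mulnS.
  by rewrite -card_edges eqT cardE.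
split; last by rewrite card_edges eqT cardE.
move=> X F [/subsetP Fe FX] F0.
(* Any subgraph on [X] has at most the edges of the induced one. *)
apply: leq_trans (_ : nedges e (enum X) + 2 <= _).
  rewrite leq_add2r -card_edges_in ?enum_uniq //; apply: subset_leq_card.
  apply/subsetP => f fF; rewrite inE Fe //=; apply/subsetP => x /(subsetP (FX f fF)).
  by rewrite inE mem_enum.
rewrite [#|X|]cardE; apply: sp; first exact: enum_uniq.
  by move=> x _; rewrite mem_enum.
have [f fF] := set0Pn _ F0; have [x [y [_ fxy]]] := edgesP _ (Fe f fF).
have : x \in X by apply: (subsetP (FX f fF)); rewrite fxy !inE eqxx.
by rewrite -mem_enum; case: (enum X).
Qed.

End Completeness.

Theorem theorem3p1 (T : finType) (e : rel T) :
  symmetric e -> irreflexive e ->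
  (tight2 2 e <-> exists V A, constructible V A /\ iso_to e V A).
Proof.
move=> syme irre; rewrite tight2P //; split=> [tT|[V [A [cV [f [injf fV surj eA]]]]]].
  have [V [A [f [cV injf mV eA]]]] := tight_realizable (leqnn _) syme irre tT.
  have inT x : x \in enum T by rewrite mem_enum.
  exists V, A; split=> //; exists f; split.
  - by move=> x y; apply: injf.
  - by move=> x; rewrite mV map_f.
  - by move=> v; rewrite mV => /mapP[x _ ->]; exists x.
  - by move=> x y; apply: eA.
(* Tightness of the constructed graph is pulled back along the isomorphism [f], which preserves
   sizes and edge counts. *)
have [uV symA irrA sp eqV] := constructible_tight cV.
have um s : uniq s -> uniq (map f s) by rewrite map_inj_uniq.
have pV : perm_eq (map f (enum T)) V.
  rewrite uniq_perm ?um ?enum_uniq // => n; apply/mapP/idP => [[x _ ->]|/surj[x <-]] //.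
  by exists x; rewrite ?mem_enum.
have nE s : nedges e s = nedges A (map f s).
  by rewrite nedges_map; apply: eq_in_nedges => x y _ _; apply: eA.
have mapV s : {subset map f s <= V} by move=> n /mapP[x _ ->].
split.
- exact: enum_uniq.
- by move=> x y _ _; apply: syme.
- by move=> x _; apply: irre.
- move=> s us _ s0; rewrite nE -(size_map f); apply: sp => //; first exact: um.
  by case: (s) s0.
rewrite nE -(size_map f) (perm_size pV) (nedges_perm _ _ pV) //.
- by move=> x y /mapV xV /mapV yV; apply: symA.
- by move=> x /mapV; apply: irrA.
Qed.
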